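(* The set $D_3$ has exactly $9$ corners, namely the points $(a_i,b_i)$, $1\le i\le 9$, given by \[ \begin{array}{lll} (a_1,b_1)=\left(\frac27,\frac37\right), & (a_2,b_2)=\left(\frac{20}{63},\frac{32}{63}\right), & (a_3,b_3)=\left(\frac{10}{31},\frac{16}{31}\right),\\ (a_4,b_4)=\left(\frac25,\frac{8}{15}\right), & (a_5,b_5)=\left(\frac37,\frac47\right), & (a_6,b_6)=\left(\frac{7}{15},\frac35\right),\\ (a_7,b_7)=\left(\frac{15}{31},\frac{21}{31}\right), & (a_8,b_8)=\left(\frac{31}{63},\frac{43}{63}\right), & (a_9,b_9)=\left(\frac47,\frac57\right). \end{array} \] Moreover, putting $a_0=0$ and $b_{10}=1$, the set $D_3$ has exactly $10$ anti-corners, namely the points $(a_i,b_{i+1})$ for $i=0,1,\dots,9$.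
   Context: Let $T:[0,1]\to[0,1]$ be the doubling map: $Tx=2x$ for $x\in[0,1/2]$ and $Tx=2x-1$ for $x\in(1/2,1]$. An $n$-cycle is a periodic orbit of $T$ of prime (least) period $n$. An integer $n\ge 3$ is called bad for $(a,b)$ if every $n$-cycle of $T$ has non-empty intersection with the open interval $(a,b)$ (the interval being empty if $a\ge b$). $B(a,b)$ denotes the set of all $n\ge3$ which are bad for $(a,b)$, and \[ D_3=\{(a,b)\in(0,1)\times(0,1): B(a,b)=\varnothing\}. \] A point $(a,b)\in\mathbb R^2$ is a corner of $D_3$ if for all $(a',b')$ sufficiently close to $(a,b)$: if $a'>a$ or $b'<b$ then $(a',b')\in D_3$; and if $a'<a$ and $b'>b$ then $(a',b')\notin D_3$. A point $(a,b)\in\mathbb R^2$ is an anti-corner of $D_3$ if for all $(a',b')$ sufficiently close to $(a,b)$: if $a'>a$ and $b'<b$ then $(a',b')\in D_3$; and if $a'<a$ or $b'>b$ then $(a',b')\notin D_3$. *)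

(* Defs.v *)
From mathcomp Require Import all_boot all_order all_algebra.
From mathcomp Require Import all_classical all_reals all_analysis.
Import Order.TTheory GRing.Theory Num.Theory.
Import numFieldNormedType.Exports.

Set Implicit Arguments.
Unset Strict Implicit.
Unset Printing Implicit Defensive.

Local Open Scope classical_set_scope.
Local Open Scope ring_scope.

(* Total on R; only its restriction to [0, 1] is used, see [is_ncycle]. *)
Definition doubling (R : realType) (x : R) : R :=
  if x <= 1 / 2 then 2 * x else 2 * x - 1.

Definition has_least_period (X : Type) (f : X -> X) (n : nat) (x : X) : Prop :=
  [/\ (0 < n)%N, iter n f x = x &
      forall k : nat, (0 < k < n)%N -> iter k f x <> x].

Definition is_ncycle (R : realType) (n : nat) (C : set R) : Prop :=
  exists x : R, [/\ 0 <= x <= 1, has_least_period (@doubling R) n x &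
    C = range (fun k : nat => iter k (@doubling R) x)].

Definition bad (R : realType) (a b : R) (n : nat) : Prop :=
  (3 <= n)%N /\ forall C : set R, is_ncycle n C -> C `&` `]a, b[ !=set0.

Definition B (R : realType) (a b : R) : set nat := [set n | bad a b n].

Definition D3 (R : realType) : set (R * R) :=
  [set p | [/\ 0 < p.1 < 1, 0 < p.2 < 1 & B p.1 p.2 = set0]].

Definition corner (R : realType) (D : set (R * R)) (p : R * R) : Prop :=
  \forall q \near p,
    (p.1 < q.1 \/ q.2 < p.2 -> D q) /\ (q.1 < p.1 /\ p.2 < q.2 -> ~ D q).

Definition anti_corner (R : realType) (D : set (R * R)) (p : R * R) : Prop :=
  \forall q \near p,
    (p.1 < q.1 /\ q.2 < p.2 -> D q) /\ (q.1 < p.1 \/ p.2 < q.2 -> ~ D q).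

(* a_0, ..., a_9 *)
Definition a_ (R : realType) (i : nat) : R :=
  nth 0 [:: 0; 2 / 7; 20 / 63; 10 / 31; 2 / 5; 3 / 7; 7 / 15; 15 / 31;
            31 / 63; 4 / 7] i.

(* b_1, ..., b_10: the list is indexed from 1 *)
Definition b_ (R : realType) (i : nat) : R :=
  nth 0 [:: 3 / 7; 32 / 63; 16 / 31; 8 / 15; 4 / 7; 3 / 5; 21 / 31; 43 / 63;
            5 / 7; 1] i.-1.

(* Main.v *)
Require Import Defs.
From mathcomp Require Import all_boot all_order all_algebra.
From mathcomp Require Import all_classical all_reals all_analysis.
From mathcomp Require Import zify ring lra.
Import Order.TTheory GRing.Theory Num.Theory.
Import numFieldNormedType.Exports.

(** Inside the unit square, (a, b) lies in D_3 if and only if a >= a_i or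
    b <= b_i for every i in 1..9, equivalently a >= a_i and b <= b_(i+1) for
    some i in 0..9; the corners and anti-corners of such a staircase can be
    read off.

    If a < a_i and b_i < b, then some n is bad because every n-cycle meets
    [a_i, b_i]: n = 3, 6, 5, 4, 3, 4, 5, 6, 3 for i = 1, ..., 9.  The points
    of period n are fractions m/(2^n - 1), so this is a finite check.

    Conversely, for every n >= 3 some n-cycle misses (a_i, b_(i+1)).  The
    binary expansion of its points is periodic with period a word v p^k of
    length n:
      i = 0       : 011 1^k;
      i = 1, 2, 3 : 100, and 1000 (100)^k for n = 1 mod 3;
                    10000 (100)^k (i = 1, 2) or 10100 (100)^k (i = 3)
                    for n = 2 mod 3;
                    100000 (100)^k (i = 1) or 101000 (100)^k (i = 2, 3)
                    for n = 0 mod 3;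
      i = 4       : 001 (01)^k and 1100 (10)^k.
    The reflection x -> 1 - x takes care of i = 5, ..., 9.  To handle all k at
    once, each letter of v and of p is given an interval such that the inverse
    branch x -> (bit + x)/2 maps the interval of every possible next letter
    into it; the cycle then stays in these intervals. *)

(** * Cyclic words of cells and the finite checks on them *)

(** Any two cyclically consecutive letters of [v p^k] are already consecutive in the cyclic word
    [v], [p] or [v p], so three checks cover all [k]. *)
Lemma cycle_pump (T : Type) (e : rel T) (v p : seq T) (k : nat) :
  cycle e v -> cycle e p -> cycle e (v ++ p) ->
  cycle e (v ++ flatten (nseq k p)).
Proof.
case: p => [|y p].
  by have -> : flatten (nseq k [::]) = [::] :> seq T by [elim: k].
have loop z : cycle e (y :: p) -> e (last y p) z ->
    path e (last y p) (rcons (flatten (nseq k (y :: p))) z).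
  rewrite /= rcons_path => /andP[yp py] pz.
  by elim: k => [|k IHk] /=; rewrite ?pz // py rcons_cat cat_path yp.
case: v => [_ yp _|x v].
  case: k loop => // k loop; rewrite /= rcons_cat cat_path.
  move: (yp); rewrite /= rcons_path => /andP[-> py] /=.
  by have := loop y yp py; rewrite /= rcons_cat !cat_path => /andP[_ /andP[]].
rewrite /= !rcons_cat !cat_path rcons_path => /andP[-> vx] yp /= /andP[vy].
rewrite rcons_path => /andP[_ px].
case: k loop => [_|k loop] /=; first by rewrite vx.
by have := loop x yp px; rewrite /= vy => /andP[].
Qed.

(* (c, l, u) stands for points with first binary digit c in [l/D, u/D], for a
   common denominator D. *)
Definition cell : Type := bool * nat * nat.

(** The branch [x -> (c + x) / 2], with [c] the digit of [s], maps the interval of [t] into that of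
    [s]; denominators are cleared. *)
Definition cell_step (D : nat) (s t : cell) : bool :=
  (2 * s.1.2 <= t.1.2 + s.1.1 * D) && (t.2 + s.1.1 * D <= 2 * s.2).

(* The interval of the head h is disjoint from all others, so a cycle following
   h :: v ++ p ++ ... ++ p visits it once: this gives the least period. *)
Definition certificate (D A B : nat) (h : cell) (v p : seq cell) : bool :=
  [&& cycle (cell_step D) (h :: v), cycle (cell_step D) p,
      cycle (cell_step D) (h :: v ++ p), 0 < h.1.2 <= h.2, h.2 <= D,
      all (fun c => (h.2 < c.1.2) || (c.2 < h.1.2)) (v ++ p) &
      all (fun c => (c.2 <= A) || (B <= c.1.2)) (h :: v ++ p)].

Definition reflect_cell (D : nat) (c : cell) : cell :=
  (~~ c.1.1, D - c.2, D - c.1.2).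

(** The reflected certificate is recomputed: the symmetry of the doubling map under [x -> 1 - x]
    fails at [1 / 2] and is never invoked. *)
Definition both_certificates (D A B : nat) (h : cell) (v p : seq cell) : bool :=
  [&& A <= D, B <= D, certificate D A B h v p &
  certificate D (D - B) (D - A) (reflect_cell D h)
    (map (reflect_cell D) v) (map (reflect_cell D) p)].

(* The doubling map on m/N, in terms of the numerator. *)
Definition double_mod (N m : nat) : nat :=
  if 2 * m <= N then 2 * m else 2 * m - N.

(** The second alternative discards numerators that return before time [n]. The range includes
    [2 ^ n - 1], that is, the point 1. *)
Definition all_cycles_meet (n A B : nat) : bool :=
  all (fun m =>
      has (fun k => A <= iter k (double_mod (2 ^ n).-1) m <= B) (iota 0 n)
      || has (fun k => iter k (double_mod (2 ^ n).-1) m == m) (iota 1 n.-1))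
    (iota 0 (2 ^ n)).

Local Notation c0 l u := (false, l, u).
Local Notation c1 l u := (true, l, u).

(** In this and the next certificates [(A/D, B/D)] contains every gap it serves, and [D] is the
    least common denominator of its ends: [105 = 7 * 15] for [(2/7, 8/15)]. *)
Lemma cert100 : both_certificates 7 2 4 (c1 4 4) [:: c0 1 1; c0 2 2] [::].
Proof. by vm_compute. Qed.

Lemma cert1000 : both_certificates 105 30 56 (c1 56 57)
  [:: c0 7 8; c0 14 15; c0 28 30] [:: c1 59 60; c0 14 15; c0 28 30].
Proof. by vm_compute. Qed.

Lemma cert10000 : both_certificates 217 62 112 (c1 112 113)
  [:: c0 7 8; c0 14 16; c0 28 31; c0 56 62] [:: c1 122 124; c0 28 31; c0 56 62].
Proof. by vm_compute. Qed.

Lemma cert100000 : both_certificates 63 18 32 (c1 32 33)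
  [:: c0 1 2; c0 2 3; c0 4 5; c0 8 9; c0 16 18] [:: c1 35 36; c0 8 9; c0 16 18].
Proof. by vm_compute. Qed.

Lemma cert101000 : both_certificates 315 100 168 (c1 199 200)
  [:: c0 84 85; c1 168 170; c0 22 25; c0 45 50; c0 90 100]
  [:: c1 180 183; c0 45 50; c0 90 100].
Proof. by vm_compute. Qed.

Lemma cert10100 : both_certificates 217 70 124 (c1 139 140)
  [:: c0 62 63; c1 124 126; c0 31 35; c0 62 70]
  [:: c1 124 126; c0 31 35; c0 62 70].
Proof. by vm_compute. Qed.

Lemma cert001 : both_certificates 35 14 20 (c0 5 6)
  [:: c0 10 12; c1 20 24] [:: c0 10 12; c1 20 24].
Proof. by vm_compute. Qed.

Lemma cert1100 : both_certificates 35 14 20 (c1 27 28)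
  [:: c1 20 21; c0 5 7; c0 11 14] [:: c1 23 25; c0 11 14].
Proof. by vm_compute. Qed.

Lemma cert011 : both_certificates 7 0 3 (c0 3 4)
  [:: c1 6 7; c1 5 7] [:: c1 5 7].
Proof. by vm_compute. Qed.

Local Open Scope classical_set_scope.
Local Open Scope ring_scope.

(** * From certificates to periodic orbits *)

Definition pull (R : realType) (s : seq cell) (y : R) : R :=
  foldr (fun (c : cell) z => (c.1.1%:R + z) / 2) y s.

Definition in_cell (R : realType) (D : nat) (c : cell) (y : R) : bool :=
  c.1.2%:R <= D%:R * y <= c.2%:R.

Lemma pull_affine (R : realType) (s : seq cell) :
  exists N : R, forall y, pull R s y = (N + y) / 2 ^+ size s.
Proof.
elim: s => [|c s [N HN]] /=; first by exists 0 => y; rewrite expr0 divr1 add0r.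
exists (c.1.1%:R * 2 ^+ size s + N) => y; rewrite HN exprS.
have : 2 ^+ size s != 0 :> R by rewrite expf_neq0 // pnatr_eq0.
by move=> ?; field.
Qed.

Lemma pull_itv (R : realType) (s : seq cell) (y : R) :
  0 < y <= 1 -> 0 < pull R s y <= 1.
Proof. by move=> y01; elim: s => //= -[[[] l] u] s /=; lra. Qed.

(** The bound [0 < z] matters: [c = 1], [z = 0] would give [1 / 2], which is sent to 1 instead of
    0. *)
Lemma doubling_half (R : realType) (c : bool) (z : R) :
  0 < z <= 1 -> doubling ((c%:R + z) / 2) = z.
Proof. by move=> z01; rewrite /doubling; case: c; case: ifPn => /=; lra. Qed.

Lemma iter_doubling_pull (R : realType) (s : seq cell) (y : R) (j : nat) :
  0 < y <= 1 -> (j <= size s)%N ->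
  iter j (@doubling R) (pull R s y) = pull R (drop j s) y.
Proof.
move=> y01; elim: j s => [|j IHj] s; first by rewrite drop0.
case: s => [//|c s] js; rewrite iterSr /=.
by rewrite doubling_half ?IHj //; exact: pull_itv.
Qed.

Lemma pull_in_cell (R : realType) (D : nat) (s : seq cell) (t : cell) (y : R)
    (j : nat) :
  sorted (cell_step D) (rcons s t) -> in_cell R D t y -> (j <= size s)%N ->
  in_cell R D (nth t s j) (pull R (drop j s) y).
Proof.
move=> + ty; elim: s j => [|c s IHs] [|j] //= cs js; last first.
  by apply: IHs => //; exact: path_sorted cs.
have {IHs} := IHs 0%N (path_sorted cs) isT; rewrite drop0.
have: cell_step D c (nth t s 0) by case: s cs {js} => [|d s] /= /andP[].
rewrite /cell_step /in_cell -!(ler_nat R) !natrD !natrM.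
by move: (pull R s y) => z; lra.
Qed.

(** The pullback is an affine contraction [y -> (N + y) / P] with [P > 1]. As both ends of the
    interval of [h] stay inside it, so does the fixed point [N / (P - 1)]. *)
Lemma pull_fixpoint (R : realType) (D : nat) (h : cell) (s : seq cell) :
  cycle (cell_step D) (h :: s) -> (0 < h.1.2 <= h.2)%N -> (0 < D)%N ->
  exists2 x : R, in_cell R D h x & pull R (h :: s) x = x.
Proof.
move=> hs /andP[h0 hle] D0.
have [N [P P1 HN]] : exists N, exists2 P : R, 1 < P &
    forall y, pull R (h :: s) y = (N + y) / P.
  have [N HN] := pull_affine R (h :: s); exists N, (2 ^+ (size s).+1) => //.
  by rewrite exprn_egt1 // ltr1n.
have D0R : 0 < D%:R :> R by rewrite ltr0n.
have stable (y : R) : in_cell R D h y -> in_cell R D h (pull R (h :: s) y).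
  by move=> hy; have := @pull_in_cell R D (h :: s) h y 0%N hs hy isT.
have mulDK (z : R) : D%:R * (z / D%:R) = z by field; rewrite gt_eqF.
have /stable : in_cell R D h (h.1.2%:R / D%:R).
  by rewrite /in_cell mulDK lexx ler_nat.
have /stable : in_cell R D h (h.2%:R / D%:R).
  by rewrite /in_cell mulDK lexx ler_nat hle.
rewrite !HN /in_cell => /andP[_ uN] /andP[lN _].
have P0 : 0 < P by lra.
have Pm : 0 < P - 1 by lra.
exists (N / (P - 1)); last by rewrite HN; field; lra.
move: uN lN; rewrite !mulrA !mulrDr !mulDK.
rewrite ler_pdivrMr // ler_pdivlMr // => uN lN.
by rewrite ler_pdivlMr // ler_pdivrMr //; lra.
Qed.

Lemma ncycle_of_cells (R : realType) (D A B : nat) (h : cell) (s : seq cell) :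
  cycle (cell_step D) (h :: s) -> (0 < h.1.2 <= h.2)%N -> (h.2 <= D)%N ->
  all (fun c => (h.2 < c.1.2) || (c.2 < h.1.2))%N s ->
  all (fun c => (c.2 <= A) || (B <= c.1.2))%N (h :: s) ->
  exists2 C : set R, is_ncycle (size s).+1 C
    & C `&` `]A%:R / D%:R, B%:R / D%:R[ = set0.
Proof.
move=> hs /[dup] h0 /andP[hl hle] hD disj avoid.
have D0 : (0 < D)%N by exact: leq_trans (leq_trans hl hle) hD.
have D0R : 0 < D%:R :> R by rewrite ltr0n.
have [x hx fx] := @pull_fixpoint R D h s hs h0 D0.
have x01 : 0 < x <= 1.
  move: hx => /andP[lx xu].
  rewrite -(pmulr_rgt0 _ D0R) (lt_le_trans _ lx) ?ltr0n //=.
  by rewrite -(ler_pM2l D0R) mulr1 (le_trans xu) // ler_nat.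
have orb j : (j <= size (h :: s))%N ->
    iter j (@doubling R) x = pull R (drop j (h :: s)) x.
  by move=> js; rewrite -{1}fx iter_doubling_pull.
have cells j : (j <= size (h :: s))%N ->
    in_cell R D (nth h (h :: s) j) (iter j (@doubling R) x).
  by move=> js; rewrite orb //; exact: pull_in_cell.
have per : iter (size s).+1 (@doubling R) x = x.
  by rewrite orb //= drop_size.
exists (range (fun k : nat => iter k (@doubling R) x)).
  exists x; split=> //; first by case/andP: x01 => /ltW -> ->.
  split=> // k /andP[k0 kn] kx.
  have := cells k (ltnW kn); rewrite kx.
  move: kn hx; case: k k0 {kx} => // k _ kn hx /= ckx.
  have /orP := all_nthP h disj k kn.
  rewrite -!(ltr_nat R); move: hx ckx; rewrite /in_cell.
  by move: (nth h s k) => c; lra.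
have iter_per m k : iter (m * (size s).+1 + k) (@doubling R) x
    = iter k (@doubling R) x.
  rewrite addnC iterD; congr iter.
  by elim: m => // m IHm; rewrite mulSn iterD IHm.
apply/seteqP; split=> // y /= [[k _ <-]].
rewrite (divn_eq k (size s).+1) iter_per in_itv /=.
have kn := ltn_pmod k (ltn0Sn (size s)).
move: (k %% _)%N kn => j jn.
have := cells j (ltnW jn).
have /orP := all_nthP h avoid j jn.
rewrite -!(ler_nat R) /in_cell ltr_pdivrMr // ltr_pdivlMr //.
by move: (nth h _ j) (iter j _ _) => c z; lra.
Qed.

(** * Cycles of every length avoiding the gaps *)

Definition avoidable (R : realType) (a b : R) (n : nat) : Prop :=
  exists2 C : set R, is_ncycle n C & C `&` `]a, b[ = set0.

Definition avoidable_sym (R : realType) (a b : R) (n : nat) : Prop :=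
  avoidable R a b n /\ avoidable R (1 - b) (1 - a) n.

Lemma avoidable_sub (R : realType) (a b a' b' : R) (n : nat) :
  a <= a' -> b' <= b -> avoidable R a b n -> avoidable R a' b' n.
Proof.
move=> aa bb [C nC Cab]; exists C => //; rewrite -subset0 -Cab.
apply: setIS => x /=; rewrite !in_itv /= => /andP[ax xb].
by rewrite (le_lt_trans aa ax) (lt_le_trans xb bb).
Qed.

Lemma avoidable_sym_sub (R : realType) (a b a' b' : R) (n : nat) :
  a <= a' -> b' <= b -> avoidable_sym R a b n -> avoidable_sym R a' b' n.
Proof.
by move=> aa bb [abn abn']; split; [move: abn|move: abn'];
  apply: avoidable_sub => //; rewrite lerD2l lerN2.
Qed.

Lemma avoidable_certificate (R : realType) (D A B : nat) (h : cell)
    (v p : seq cell) (k : nat) :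
  certificate D A B h v p ->
  avoidable R (A%:R / D%:R) (B%:R / D%:R) ((size v).+1 + k * size p).
Proof.
move=> /and5P[hv pp hvp h0 /and3P[hD disj avoid]].
have := @cycle_pump _ _ (h :: v) p k hv pp hvp.
rewrite cat_cons => /(@ncycle_of_cells R D A B) []//.
- move: disj; rewrite !all_cat => /andP[-> dp] /=.
  by elim: k => //= k IHk; rewrite all_cat dp.
- move: avoid; rewrite -!cat_cons !all_cat => /andP[-> dp] /=.
  by elim: k => //= k IHk; rewrite all_cat dp.
move=> C nC CAB; exists C => //; move: nC; rewrite size_cat addSn.
suff -> : size (flatten (nseq k p)) = (k * size p)%N by [].
by elim: k => //= k IHk; rewrite size_cat IHk mulSn.
Qed.

Lemma avoidable_both (R : realType) (D A B : nat) (h : cell)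
    (v p : seq cell) (k : nat) :
  both_certificates D A B h v p ->
  avoidable_sym R (A%:R / D%:R) (B%:R / D%:R) ((size v).+1 + k * size p).
Proof.
move=> /and4P[AD BD cert rcert]; split; first exact: avoidable_certificate cert.
have D0 : D%:R != 0 :> R.
  case/and5P: cert => _ _ _ /andP[h0 h1] /andP[hD _].
  by rewrite pnatr_eq0 -lt0n; exact: leq_trans (leq_trans h0 h1) hD.
have := avoidable_certificate R _ _ _ _ _ _ k rcert.
by rewrite !size_map !natrB // !mulrBl divff.
Qed.

Lemma gap_avoidable_sym (R : realType) (i n : nat) :
  (i <= 4)%N -> (3 <= n)%N -> avoidable_sym R (a_ R i) (b_ R i.+1) n.
Proof.
move=> i4 n3.
(* Words built on [01] grow by 2 and those on [100] by 3: [i = 4] needs the parity of [n], and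
   [i = 1, 2, 3] its residue mod 3. The mod 3 families start at lengths 4, 5, 6, so [n = 3] is set
   apart. *)
have [k n_mod2] : exists k, n = (3 + k * 2)%N \/ n = (4 + k * 2)%N.
  by exists ((n - 3) %/ 2)%N; lia.
have [->|[j n_mod3]] : n = 3 \/ exists j,
    [\/ n = (4 + j * 3)%N, n = (5 + j * 3)%N | n = (6 + j * 3)%N].
  have [->|n4] := eqVneq n 3; [by left|right; exists ((n - 4) %/ 3)%N].
  have : ((n - 4) %% 3 < 3)%N by rewrite ltn_mod.
  move: (divn_eq (n - 4) 3); case: ((n - 4) %% 3)%N => [|[|[|//]]] nE _.
  - by constructor 1; lia.
  - by constructor 2; lia.
  - by constructor 3; lia.
all: case: i i4 => [|[|[|[|[|//]]]]] _.
- by apply: avoidable_sym_sub (avoidable_both R _ _ _ _ _ _ 0 cert011);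
    rewrite /a_ /b_ /=; lra.
1-4: by apply: avoidable_sym_sub (avoidable_both R _ _ _ _ _ _ 0 cert100);
     rewrite /a_ /b_ /=; lra.
- have -> : n = (3 + (n - 3) * 1)%N by lia.
  by apply: avoidable_sym_sub (avoidable_both R _ _ _ _ _ _ _ cert011);
    rewrite /a_ /b_ /=; lra.
4: by case: n_mod2 => ->;
  [apply: avoidable_sym_sub (avoidable_both R _ _ _ _ _ _ k cert001)
  |apply: avoidable_sym_sub (avoidable_both R _ _ _ _ _ _ k cert1100)];
  rewrite /a_ /b_ /=; lra.
all: case: n_mod3 => ->.
1,4,7: by apply: avoidable_sym_sub (avoidable_both R _ _ _ _ _ _ j cert1000);
     rewrite /a_ /b_ /=; lra.
1,3: by apply: avoidable_sym_sub (avoidable_both R _ _ _ _ _ _ j cert10000);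
     rewrite /a_ /b_ /=; lra.
2: by apply: avoidable_sym_sub (avoidable_both R _ _ _ _ _ _ j cert101000);
     rewrite /a_ /b_ /=; lra.
1: by apply: avoidable_sym_sub (avoidable_both R _ _ _ _ _ _ j cert100000);
     rewrite /a_ /b_ /=; lra.
1: by apply: avoidable_sym_sub (avoidable_both R _ _ _ _ _ _ j cert10100);
     rewrite /a_ /b_ /=; lra.
by apply: avoidable_sym_sub (avoidable_both R _ _ _ _ _ _ j cert101000);
    rewrite /a_ /b_ /=; lra.
Qed.

(** The reflection [x -> 1 - x] exchanges gaps [i] and [9 - i]. *)
Lemma b_reflect (R : realType) (i : nat) :
  (i <= 9)%N -> b_ R i.+1 = 1 - a_ R (9 - i).
Proof. by do 10?[case: i => [|i] //] => _; rewrite /a_ /b_ /=; field. Qed.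

Lemma gap_avoidable (R : realType) (i n : nat) :
  (i <= 9)%N -> (3 <= n)%N -> avoidable R (a_ R i) (b_ R i.+1) n.
Proof.
move=> i9 n3; have [i4|i5] := leqP i 4.
  by case: (gap_avoidable_sym R i n i4 n3).
have j4 : (9 - i <= 4)%N by lia.
have [_] := gap_avoidable_sym R (9 - i)%N n j4 n3.
by rewrite !b_reflect ?leq_subr // subKn // subKr.
Qed.

(** * Periodic points as fractions, and bad lengths *)

(** Each step subtracts 0 or an integer after doubling, so a point of period [n] satisfies
    [(2 ^ n - 1) * x = j]. *)
Lemma iter_doubling_affine (R : realType) (n : nat) (x : R) :
  exists j : nat, iter n (@doubling R) x = 2 ^+ n * x - j%:R.
Proof.
elim: n => [|n [j IHn]]; first by exists 0%N; rewrite expr0 mul1r subr0.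
rewrite iterS IHn /doubling exprS; case: ifPn => _.
  by exists (2 * j)%N; rewrite natrM; ring.
by exists (2 * j + 1)%N; rewrite natrD natrM; ring.
Qed.

Lemma periodic_point_frac (R : realType) (n : nat) (x : R) :
  (0 < n)%N -> 0 <= x <= 1 -> iter n (@doubling R) x = x ->
  exists2 m : nat, (m < 2 ^ n)%N & x = m%:R / (2 ^ n).-1%:R.
Proof.
move=> n0 /andP[x0 x1]; have [j ->] := iter_doubling_affine R n x.
have N1 : 1 < 2 ^+ n :> R by rewrite exprn_egt1 ?ltr1n // -lt0n.
have NE : (2 ^ n).-1%:R = 2 ^+ n - 1 :> R.
  by rewrite -subn1 natrB ?expn_gt0 // natrX.
move=> fx; have jE : j%:R = x * (2 ^+ n - 1) by lra.
exists j; last by rewrite NE jE mulfK //; lra.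
by rewrite -(ltr_nat R) jE natrX; nra.
Qed.

Lemma doubling_frac (R : realType) (N m : nat) : (0 < N)%N ->
  doubling (m%:R / N%:R) = (double_mod N m)%:R / N%:R :> R.
Proof.
move=> N0; have N0R : 0 < N%:R :> R by rewrite ltr0n.
rewrite /doubling ler_pdivrMr // /double_mod.
have -> : (m%:R <= 1 / 2 * N%:R :> R) = (2 * m <= N)%N.
  by rewrite -(ler_nat R) natrM; apply/idP/idP; lra.
case: leqP => [_|/ltnW Nm]; first by rewrite natrM mulrA.
by rewrite natrB // natrM; field; rewrite gt_eqF.
Qed.

Lemma iter_doubling_frac (R : realType) (N m k : nat) : (0 < N)%N ->
  iter k (@doubling R) (m%:R / N%:R) = (iter k (double_mod N) m)%:R / N%:R.
Proof. by move=> N0; elim: k => //= k ->; rewrite doubling_frac. Qed.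

Lemma bad_all_cycles_meet (R : realType) (n A B : nat) (a b : R) :
  all_cycles_meet n A B -> (3 <= n)%N ->
  a < A%:R / (2 ^ n).-1%:R -> B%:R / (2 ^ n).-1%:R < b -> bad a b n.
Proof.
move=> meet n3 aA Bb; split=> // C [x [x01 [n0 perx leastx] ->]].
have [m mlt xE] := periodic_point_frac R n x n0 x01 perx.
have N0 : (0 < (2 ^ n).-1)%N.
  by rewrite -subn1 subn_gt0; exact: leq_trans (ltn_expl n (ltnSn 1)).
have N0R : 0 < (2 ^ n).-1%:R :> R by rewrite ltr0n.
have /allP/(_ m) := meet; rewrite mem_iota add0n => /(_ mlt) /orP[|] /hasP[k].
  move=> _ /andP[Ak kB]; exists (iter k (@doubling R) x).
  split; first by exists k.
  rewrite /= in_itv /= xE iter_doubling_frac //; apply/andP; split.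
    by rewrite (lt_le_trans aA) // ler_pM2r ?invr_gt0 // ler_nat.
  by rewrite (le_lt_trans _ Bb) // ler_pM2r ?invr_gt0 // ler_nat.
(* The other alternative is a return at a time [0 < k < n], against the least period. *)
rewrite mem_iota => kn /eqP km; case: (leastx k); first by lia.
by rewrite xE iter_doubling_frac // km.
Qed.

(** Equations for [a'] and [b'] let a reduced fraction such as [2 / 5] be supplied as [6 / 15]. *)
Lemma bad_corner_frac (R : realType) (n A B : nat) (a b a' b' : R) :
  all_cycles_meet n A B -> (3 <= n)%N ->
  a' = A%:R / (2 ^ n).-1%:R -> b' = B%:R / (2 ^ n).-1%:R ->
  a < a' -> b' < b -> exists n, bad a b n.
Proof.
move=> meet n3 -> -> aA Bb; exists n; exact: bad_all_cycles_meet meet n3 aA Bb.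
Qed.

Lemma bad_corner (R : realType) (i : nat) (a b : R) : (1 <= i <= 9)%N ->
  a < a_ R i -> b_ R i < b -> exists n, bad a b n.
Proof.
case: i => [|[|[|[|[|[|[|[|[|[|//]]]]]]]]]] // _;
  [ apply: (bad_corner_frac R 3 2 3) | apply: (bad_corner_frac R 6 20 32)
  | apply: (bad_corner_frac R 5 10 16) | apply: (bad_corner_frac R 4 6 8)
  | apply: (bad_corner_frac R 3 3 4) | apply: (bad_corner_frac R 4 7 9)
  | apply: (bad_corner_frac R 5 15 21) | apply: (bad_corner_frac R 6 31 43)
  | apply: (bad_corner_frac R 3 4 5) ];
  by [vm_compute | rewrite /a_ /b_ /=; field].
Qed.

(** * The staircase description of [D3] *)

(** The smallest difference is [a_3 - a_2 = 10/1953], just above [1/200], which then serves as a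
    uniform radius around all vertices. *)
Lemma a_gap (R : realType) (i j : nat) :
  (i < j <= 9)%N -> a_ R i + 1 / 200 <= a_ R j.
Proof.
by case: i => [|[|[|[|[|[|[|[|[|[|i]]]]]]]]]];
  case: j => [|[|[|[|[|[|[|[|[|[|j]]]]]]]]]] //; rewrite /a_ /=; lra || lia.
Qed.

Lemma b_gap (R : realType) (i j : nat) :
  (1 <= i < j)%N -> (j <= 10)%N -> b_ R i + 1 / 200 <= b_ R j.
Proof.
case: i j => [|i] [|j] //= ij j9; rewrite !b_reflect; try lia.
have : (9 - j < 9 - i <= 9)%N by lia.
by move=> /(a_gap R); lra.
Qed.

Lemma a_bounds (R : realType) (i : nat) : (i <= 9)%N -> 0 <= a_ R i <= 4 / 7.
Proof. by do 10?[case: i => [|i] //] => _; rewrite /a_ /=; lra. Qed.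

Lemma b_bounds (R : realType) (i : nat) :
  (1 <= i <= 10)%N -> 3 / 7 <= b_ R i <= 1.
Proof.
case: i => //= i i9; rewrite b_reflect //.
by have := a_bounds R (9 - i) (leq_subr _ _); lra.
Qed.

Lemma D3_corner (R : realType) (x y : R) (i : nat) :
  @D3 R (x, y) -> (1 <= i <= 9)%N -> a_ R i <= x \/ y <= b_ R i.
Proof.
move=> [_ _ /= B0] i19; case: (leP (a_ R i) x) => [|xa]; first by left.
case: (leP y (b_ R i)) => [|by_]; first by right.
have [n bn] := bad_corner R i x y i19 xa by_.
by have : B x y n by []; rewrite B0.
Qed.

Lemma D3_gap (R : realType) (x y : R) (i : nat) :
  0 < x < 1 -> 0 < y < 1 -> (i <= 9)%N -> a_ R i <= x -> y <= b_ R i.+1 ->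
  @D3 R (x, y).
Proof.
move=> x01 y01 i9 ax yb; split=> //=; apply/seteqP; split=> // n [n3 hit].
have [C nC C0] := avoidable_sub R _ _ _ _ _ ax yb (gap_avoidable R i n i9 n3).
by have [z] := hit C nC; rewrite C0.
Qed.

(** Take the last [i] with [a_i <= x], which exists since [a_0 = 0]. Either constraint [i + 1]
    forces [y <= b_(i+1)], or [i = 9] and [b_10 = 1]. *)
Lemma corners_gap (R : realType) (x y : R) : 0 < x -> y < 1 ->
  (forall i, (1 <= i <= 9)%N -> a_ R i <= x \/ y <= b_ R i) ->
  exists i, [/\ (i <= 9)%N, a_ R i <= x & y <= b_ R i.+1].
Proof.
move=> x0 y1 cnf.
have ex0 : exists i, (i <= 9)%N && (a_ R i <= x).
  by exists 0%N; rewrite /a_ /= ltW.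
have le9 i : (i <= 9)%N && (a_ R i <= x) -> (i <= 9)%N by case/andP.
have [i /andP[i9 ax] imax] := ex_maxnP ex0 le9.
exists i; split => //; move: i9; rewrite leq_eqVlt => /orP[/eqP ->|i9].
  by rewrite /b_ /= ltW.
case: (cnf i.+1 i9) => // ax'.
by have := imax i.+1; rewrite ax' i9 ltnn => /(_ isT).
Qed.

Lemma D3_corners (R : realType) (x y : R) : 0 < x < 1 -> 0 < y < 1 ->
  (forall i, (1 <= i <= 9)%N -> a_ R i <= x \/ y <= b_ R i) -> @D3 R (x, y).
Proof.
move=> /[dup] x01 /andP[x0 _] /[dup] y01 /andP[_ y1] /(corners_gap R x y x0 y1).
by move=> [i [i9 ax yb]]; exact: D3_gap x01 y01 i9 ax yb.
Qed.

(** * Reading off corners and anti-corners *)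

Lemma near_pair (R : realType) (p : R * R) (P : set (R * R)) :
  (\forall q \near p, P q) <-> exists2 e, 0 < e
    & forall x y, `|p.1 - x| < e -> `|p.2 - y| < e -> P (x, y).
Proof.
split=> [/nbhs_ballP[e /= e0 eP]|[e e0 eP]].
  by exists e => // x y px py; apply: eP; split; rewrite /= -ball_normE.
apply/nbhs_ballP; exists e => //= -[x y] [/=]; rewrite -!ball_normE /=.
exact: eP.
Qed.

(** Finite sets are closed. This allows the vertex found near [p] to depend on the scale [d]. *)
Lemma finite_set_approx (R : realType) (S : set (R * R)) (p : R * R) (e : R) :
  finite_set S -> 0 < e ->
  (forall d, 0 < d < e ->
    exists2 q, S q & `|p.1 - q.1| <= d /\ `|p.2 - q.2| <= d) ->
  S p.
Proof.
move=> finS e0 approx.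
have /closure_id -> : closed S.
  have [+ _] := @accessible_finite_set_closed (R * R)%type.
  by apply=> //; apply: hausdorff_accessible; exact: norm_hausdorff.
move=> V /near_pair[e' e'0 e'V].
pose d := Num.min e e' / 2.
have : [/\ 0 < d, d < e & d < e'].
  by rewrite /d; case: (leP e e') => ee'; split; lra.
case=> d0 de de'; have [|q Sq [q1 q2]] := approx d; first by rewrite d0.
exists q; split=> //; rewrite [q]surjective_pairing.
by apply: e'V; exact: le_lt_trans de'.
Qed.

Lemma corner_vertex (R : realType) (i : nat) : (1 <= i <= 9)%N ->
  corner (@D3 R) (a_ R i, b_ R i).
Proof.
move=> /[dup] i19 /andP[i1 i9].
have i10 : (1 <= i <= 10)%N by rewrite i1 leqW.
have i1_10 : (1 <= i < 10)%N by rewrite i1 ltnS.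
apply/near_pair; exists (1 / 200); first by lra.
move=> x y /=; rewrite !ltr_norml => xa yb.
(* Comparison with [a_0 = 0] and [b_10 = 1] keeps [x] above 0 and [y] below 1. *)
have a0 := a_gap R 0 i i19; have a00 : a_ R 0 = 0 by [].
have b1 := b_gap R i 10 i1_10 isT; have b11 : b_ R 10 = 1 by [].
have ab := a_bounds R i i9; have bb := b_bounds R i i10.
split=> [q|[xa' yb'] D]; last by case: (D3_corner R x y i D i19); lra.
apply: D3_corners; [lra|lra|] => j /andP[j1 j9].
(* Near vertex [i] the constraints [j > i] hold through [y] and those with [j < i] through [x]; only
   constraint [i] is active. *)
have [ij|ji|<-] := ltngtP i j; last by case: q => q; [left|right]; lra.
  have i1j : (1 <= i < j)%N by rewrite i1.
  by right; have := b_gap R i j i1j (leqW j9); lra.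
have ji9 : (j < i <= 9)%N by rewrite ji.
by left; have := a_gap R j i ji9; lra.
Qed.

(** Constraint [i] blocks moving left and constraint [i + 1] blocks moving up; for [i = 0] and
    [i = 9] respectively, an edge of the unit square does so. *)
Lemma anti_corner_vertex (R : realType) (i : nat) : (i <= 9)%N ->
  anti_corner (@D3 R) (a_ R i, b_ R i.+1).
Proof.
move=> i9; apply/near_pair; exists (1 / 200); first by lra.
move=> x y /=; rewrite !ltr_norml => xa yb.
have ab := a_bounds R i i9.
have bb : 3 / 7 <= b_ R i.+1 <= 1 by apply: b_bounds.
split=> [q|q D]; first by apply: (D3_gap R x y i) => //; lra.
have [/= x01 y01 _] := D; case: q => q.
  case: i i9 xa yb ab bb q => [|i] i9 xa yb ab bb q.
    by move: q; rewrite /a_ /=; lra.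
  case: (D3_corner R x y i.+1 D i9); first by lra.
  have i12 : (1 <= i.+1 < i.+2)%N by rewrite ltnSn.
  by have := b_gap R i.+1 i.+2 i12 i9; lra.
move: i9; rewrite leq_eqVlt => /orP[/eqP i9|i9].
  by move: q; rewrite i9 /b_ /=; lra.
case: (D3_corner R x y i.+1 D i9); last by lra.
by have := a_gap R i i.+1; rewrite ltnSn i9 => /(_ isT); lra.
Qed.

Lemma corner_inv (R : realType) (p : R * R) : corner (@D3 R) p ->
  [set (a_ R i, b_ R i) | i in [set i : nat | (1 <= i <= 9)%N]] p.
Proof.
move=> /near_pair[e e0 C]; apply: (finite_set_approx _ _ _ e) => //.
  apply: finite_image; apply: (sub_finite_set _ (finite_II 10)) => i /=; lia.
move=> d /andP[d0 de].
have nearD (z : R) : `|z - (z + d)| < e by rewrite ltr_norml; lra.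
have nearB (z : R) : `|z - (z - d)| < e by rewrite ltr_norml; lra.
have [Dpp _] := C _ _ (nearD p.1) (nearD p.2).
have [Dmm _] := C _ _ (nearB p.1) (nearB p.2).
have [_ Dmp] := C _ _ (nearB p.1) (nearD p.2).
have {}Dpp : @D3 R (p.1 + d, p.2 + d) by apply: Dpp; left => /=; lra.
have {}Dmm : @D3 R (p.1 - d, p.2 - d) by apply: Dmm; right => /=; lra.
have {}Dmp : ~ @D3 R (p.1 - d, p.2 + d) by apply: Dmp; split=> /=; lra.
have [/= x1 y1 _] := Dpp; have [/= x0 y0 _] := Dmm.
(* The excluded point violates some constraint [i]; the two points of [D3] satisfy it, which gives
   the opposite bounds on [a_i] and [b_i]. *)
have [i i19 [xa yb]] : exists2 i, (1 <= i <= 9)%N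
    & p.1 - d < a_ R i /\ b_ R i < p.2 + d.
  apply: contrapT => none; apply: Dmp; apply: D3_corners; [lra|lra|] => i i19.
  case: (leP (a_ R i) (p.1 - d)) => [|xa]; first by left.
  case: (leP (p.2 + d) (b_ R i)) => [|yb]; first by right.
  by case: none; exists i.
exists (a_ R i, b_ R i); first by exists i.
rewrite /= !ler_norml.
have := D3_corner R _ _ i Dpp i19; have := D3_corner R _ _ i Dmm i19.
by split; lra.
Qed.

Lemma anti_corner_inv (R : realType) (p : R * R) : anti_corner (@D3 R) p ->
  [set (a_ R i, b_ R i.+1) | i in [set i : nat | (0 <= i <= 9)%N]] p.
Proof.
move=> /near_pair[e e0 C]; apply: (finite_set_approx _ _ _ e) => //.
  apply: finite_image; apply: (sub_finite_set _ (finite_II 10)) => i /=; lia.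
move=> d /andP[d0 de].
have nearD (z : R) : `|z - (z + d)| < e by rewrite ltr_norml; lra.
have nearB (z : R) : `|z - (z - d)| < e by rewrite ltr_norml; lra.
have [_ Dpp] := C _ _ (nearD p.1) (nearD p.2).
have [_ Dmm] := C _ _ (nearB p.1) (nearB p.2).
have [Dpm _] := C _ _ (nearD p.1) (nearB p.2).
have {}Dpp : ~ @D3 R (p.1 + d, p.2 + d) by apply: Dpp; right => /=; lra.
have {}Dmm : ~ @D3 R (p.1 - d, p.2 - d) by apply: Dmm; left => /=; lra.
have {}Dpm : @D3 R (p.1 + d, p.2 - d) by apply: Dpm; split=> /=; lra.
have [/= x1 y0 _] := Dpm.
(* The point in [D3] selects a gap; were [a_i] or [b_(i+1)] farther than [d] from [p], one of the
   two excluded points would lie in [D3] too. *)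
have [|||i [i9 ax yb]] := corners_gap R (p.1 + d) (p.2 - d); [lra|lra| |].
  by move=> i; exact: D3_corner Dpm.
have ab := a_bounds R i i9.
have bb : 3 / 7 <= b_ R i.+1 <= 1 by apply: b_bounds.
exists (a_ R i, b_ R i.+1); first by exists i.
have xa : p.1 - d <= a_ R i.
  rewrite leNgt; apply/negP => ax'; apply: Dmm.
  by apply: (D3_gap R _ _ i) => //; lra.
have by_ : b_ R i.+1 <= p.2 + d.
  rewrite leNgt; apply/negP => yb'; apply: Dpp.
  by apply: (D3_gap R _ _ i) => //; lra.
by rewrite /= !ler_norml; split; lra.
Qed.

(** The first coordinates [a_i] alone already separate the points. *)
Lemma vertices_card (R : realType) (f : nat -> nat) (A : set nat) (n : nat) :
  (forall i, A i -> (i <= 9)%N) -> (A #= `I_n)%card ->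
  ([set (a_ R i, b_ R (f i)) | i in A] #= `I_n)%card.
Proof.
move=> A9; apply: card_eq_trans; apply: inj_card_eq => i j.
rewrite !inE => /A9 i9 /A9 j9 [aij _].
have [ij|ji|//] := ltngtP i j.
  by exfalso; have := a_gap R i j; rewrite ij j9 => /(_ isT); lra.
by exfalso; have := a_gap R j i; rewrite ji i9 => /(_ isT); lra.
Qed.

Theorem theorem2p3 (R : realType) :
  ([set p : R * R | corner (@D3 R) p]
     = [set (a_ R i, b_ R i) | i in [set i : nat | (1 <= i <= 9)%N]] /\
   ([set p : R * R | corner (@D3 R) p] #= `I_9)%card) /\
  ([set p : R * R | anti_corner (@D3 R) p]
     = [set (a_ R i, b_ R i.+1) | i in [set i : nat | (0 <= i <= 9)%N]] /\
   ([set p : R * R | anti_corner (@D3 R) p] #= `I_10)%card).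
Proof.
have -> : [set p : R * R | corner (@D3 R) p]
    = [set (a_ R i, b_ R i) | i in [set i : nat | (1 <= i <= 9)%N]].
  apply/seteqP; split=> [p /corner_inv //|_ [i i19 <-]].
  exact: corner_vertex.
have -> : [set p : R * R | anti_corner (@D3 R) p]
    = [set (a_ R i, b_ R i.+1) | i in [set i : nat | (0 <= i <= 9)%N]].
  apply/seteqP; split=> [p /anti_corner_inv //|_ [i i9 <-]].
  exact: anti_corner_vertex.
split; split=> //.
  apply: (vertices_card R id) => [i /andP[]//|].
  have -> : [set i : nat | (1 <= i <= 9)%N] = succn @` `I_9.
    apply/seteqP; split=> [[//|i] i9|_ [i i9 <-] //]; first by exists i.
  by apply: inj_card_eq => i j _ _ [].
exact: (vertices_card R succn).
Qed.
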